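(* Up to isomorphism, there are exactly eight commutative $g$-dimonoids of order $3$ that are not dimonoids. Representatives of the eight isomorphism classes are the following structures $(S,\dashv,\vdash)$ on $S=\{0,1,2\}$, which are pairwise nonisomorphic: (1) $x\dashv y=0$ and $x\vdash y=1$ for all $x,y\in S$. (2) $x\dashv y=x\vdash y=0$ if $x=0$ or $y=0$; and $x\dashv y=1$, $x\vdash y=2$ for all $x,y\in\{1,2\}$. (3) $$\begin{array}{c|ccc}\dashv & 0 & 1 & 2\\ \hline 0 & 0 & 0 & 2\\ 1 & 0 & 0 & 2\\ 2 & 2 & 2 & 0\end{array}\qquad\begin{array}{c|ccc}\vdash & 0 & 1 & 2\\ \hline 0 & 1 & 1 & 2\\ 1 & 1 & 1 & 2\\ 2 & 2 & 2 & 1\end{array}$$ (4) $$\begin{array}{c|ccc}\dashv & 0 & 1 & 2\\ \hline 0 & 0 & 1 & 1\\ 1 & 1 & 0 & 0\\ 2 & 1 & 0 & 0\end{array}\qquad\begin{array}{c|ccc}\vdash & 0 & 1 & 2\\ \hline 0 & 0 & 2 & 2\\ 1 & 2 & 0 & 0\\ 2 & 2 & 0 & 0\end{array}$$ (5) $$\begin{array}{c|ccc}\dashv & 0 & 1 & 2\\ \hline 0 & 0 & 0 & 0\\ 1 & 0 & 0 & 0\\ 2 & 0 & 0 & 2\end{array}\qquad\begin{array}{c|ccc}\vdash & 0 & 1 & 2\\ \hline 0 & 1 & 1 & 1\\ 1 & 1 & 1 & 1\\ 2 & 1 & 1 & 2\end{array}$$ (6) $$\begin{array}{c|ccc}\dashv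 & 0 & 1 & 2\\ \hline 0 & 0 & 0 & 0\\ 1 & 0 & 0 & 0\\ 2 & 0 & 0 & 1\end{array}\qquad\begin{array}{c|ccc}\vdash & 0 & 1 & 2\\ \hline 0 & 1 & 1 & 1\\ 1 & 1 & 1 & 1\\ 2 & 1 & 1 & 0\end{array}$$ (7) $$\begin{array}{c|ccc}\dashv & 0 & 1 & 2\\ \hline 0 & 0 & 0 & 0\\ 1 & 0 & 0 & 0\\ 2 & 0 & 0 & 0\end{array}\qquad\begin{array}{c|ccc}\vdash & 0 & 1 & 2\\ \hline 0 & 1 & 1 & 1\\ 1 & 1 & 1 & 1\\ 2 & 1 & 1 & 0\end{array}$$ (8) $$\begin{array}{c|ccc}\dashv & 0 & 1 & 2\\ \hline 0 & 1 & 1 & 1\\ 1 & 1 & 1 & 1\\ 2 & 1 & 1 & 0\end{array}\qquad\begin{array}{c|ccc}\vdash & 0 & 1 & 2\\ \hline 0 & 0 & 0 & 0\\ 1 & 0 & 0 & 0\\ 2 & 0 & 0 & 0\end{array}$$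
   Context: A $g$-dimonoid is a set $D$ with two associative binary operations $\dashv,\vdash$ satisfying, for all $x,y,z\in D$, $(D_1)$ $(x\dashv y)\dashv z=x\dashv(y\vdash z)$ and $(D_3)$ $(x\dashv y)\vdash z=x\vdash(y\vdash z)$. A dimonoid is a $g$-dimonoid which also satisfies $(D_2)$ $(x\vdash y)\dashv z=x\vdash(y\dashv z)$ for all $x,y,z\in D$. A $g$-dimonoid is commutative if both semigroups $(D,\dashv)$ and $(D,\vdash)$ are commutative. The order of a $g$-dimonoid is the cardinality of its underlying set. An isomorphism of $g$-dimonoids is a bijection preserving both operations. In the tables, the entry in row $x$ and column $y$ is the product of $x$ and $y$ (in this order). *)

(* Defs.v *)
From mathcomp Require Import all_boot.
From mathcomp Require Import zmodp.

Set Implicit Arguments.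
Unset Strict Implicit.
Unset Printing Implicit Defensive.

Record biop (D : Type) := BiOp {
  dashv : D -> D -> D;
  vdash : D -> D -> D
}.

Definition is_gdimonoid (D : Type) (d : biop D) : Prop :=
  [/\ associative (dashv d),
      associative (vdash d),
      forall x y z, dashv d (dashv d x y) z = dashv d x (vdash d y z)
    & forall x y z, vdash d (dashv d x y) z = vdash d x (vdash d y z)].

Definition is_dimonoid (D : Type) (d : biop D) : Prop :=
  is_gdimonoid d /\
  (forall x y z, dashv d (vdash d x y) z = vdash d x (dashv d y z)).

Definition is_commutative (D : Type) (d : biop D) : Prop :=
  commutative (dashv d) /\ commutative (vdash d).

Definition isomorphic (D E : Type) (d : biop D) (e : biop E) : Prop :=
  exists f : D -> E,
    [/\ bijective f,
        {morph f : x y / dashv d x y >-> dashv e x y}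
      & {morph f : x y / vdash d x y >-> vdash e x y}].

(* [inZp k] is k modulo 3, i.e. k itself for k < 3. *)
Definition elt (k : nat) : 'I_3 := inZp k.

(* Cayley table listed by rows: the product of x and y is in row x, column y. *)
Definition table (rows : seq (seq nat)) (x y : 'I_3) : 'I_3 :=
  elt (nth 0 (nth [::] rows x) y).

Definition gd1 : biop 'I_3 := BiOp (fun _ _ => elt 0) (fun _ _ => elt 1).

Definition gd2 : biop 'I_3 :=
  BiOp (fun x y => if (x == elt 0) || (y == elt 0) then elt 0 else elt 1)
       (fun x y => if (x == elt 0) || (y == elt 0) then elt 0 else elt 2).

Definition gd3 : biop 'I_3 :=
  BiOp (table [:: [:: 0; 0; 2];
                  [:: 0; 0; 2];
                  [:: 2; 2; 0]])
       (table [:: [:: 1; 1; 2];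
                  [:: 1; 1; 2];
                  [:: 2; 2; 1]]).

Definition gd4 : biop 'I_3 :=
  BiOp (table [:: [:: 0; 1; 1];
                  [:: 1; 0; 0];
                  [:: 1; 0; 0]])
       (table [:: [:: 0; 2; 2];
                  [:: 2; 0; 0];
                  [:: 2; 0; 0]]).

Definition gd5 : biop 'I_3 :=
  BiOp (table [:: [:: 0; 0; 0];
                  [:: 0; 0; 0];
                  [:: 0; 0; 2]])
       (table [:: [:: 1; 1; 1];
                  [:: 1; 1; 1];
                  [:: 1; 1; 2]]).

Definition gd6 : biop 'I_3 :=
  BiOp (table [:: [:: 0; 0; 0];
                  [:: 0; 0; 0];
                  [:: 0; 0; 1]])
       (table [:: [:: 1; 1; 1];
                  [:: 1; 1; 1];
                  [:: 1; 1; 0]]).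

Definition gd7 : biop 'I_3 :=
  BiOp (table [:: [:: 0; 0; 0];
                  [:: 0; 0; 0];
                  [:: 0; 0; 0]])
       (table [:: [:: 1; 1; 1];
                  [:: 1; 1; 1];
                  [:: 1; 1; 0]]).

Definition gd8 : biop 'I_3 :=
  BiOp (table [:: [:: 1; 1; 1];
                  [:: 1; 1; 1];
                  [:: 1; 1; 0]])
       (table [:: [:: 0; 0; 0];
                  [:: 0; 0; 0];
                  [:: 0; 0; 0]]).

Definition representatives : 8.-tuple (biop 'I_3) :=
  [tuple gd1; gd2; gd3; gd4; gd5; gd6; gd7; gd8].

(* Main.v *)
Require Import Defs.
From mathcomp Require Import all_boot.
From mathcomp Require Import zmodp.

(** A commutative operation on a three-element set is determined by the six
    entries of its Cayley table on and above the diagonal, so after numbering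
    the elements (lemma [isomorphic_symm_tables]) every commutative structure
    of order 3 is one of the 3^6 * 3^6 structures on ['I_3] given by two
    symmetric tables.  All the notions in play are invariant under isomorphism,
    and on ['I_3] they are decidable: each identity is a finite conjunction,
    and an isomorphism is one of the 27 self-maps of ['I_3]
    ([isomorphicP]).  The theorem is thus reduced to evaluating booleans.

    The evaluation is short because associativity is a condition on each table
    separately: it leaves only 63 symmetric tables, and the axioms linking the
    two operations, and then the search for an isomorphism, are only tried on
    pairs of these ([classification_symm_tables]). *)

Set Implicit Arguments.
Unset Strict Implicit.
Unset Printing Implicit Defensive.

(** * Isomorphism invariance *)

Lemma isomorphic_sym (D E : Type) (d : biop D) (e : biop E) :
  isomorphic d e -> isomorphic e d.
Proof.
case=> f [[g fK gK] fl fr]; exists g; split; first by exists f.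
- by move=> x y; rewrite -{1}(gK x) -{1}(gK y) -fl fK.
- by move=> x y; rewrite -{1}(gK x) -{1}(gK y) -fr fK.
Qed.

Lemma isomorphic_trans (C D E : Type) (c : biop C) (d : biop D) (e : biop E) :
  isomorphic c d -> isomorphic d e -> isomorphic c e.
Proof.
case=> f [bf fl fr] [g [bg gl gr]]; exists (g \o f).
by split; [exact: bij_comp | |] => x y /=; rewrite ?fl ?fr ?gl ?gr.
Qed.

Lemma is_gdimonoid_iso (D E : Type) (d : biop D) (e : biop E) :
  isomorphic d e -> is_gdimonoid d -> is_gdimonoid e.
Proof.
move=> /isomorphic_sym[g [/bij_inj g_inj gl gr]] [Al Ar D1 D3].
by split=> x y z; apply: g_inj; rewrite !(gl, gr).
Qed.

Lemma is_dimonoid_iso (D E : Type) (d : biop D) (e : biop E) :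
  isomorphic d e -> is_dimonoid d -> is_dimonoid e.
Proof.
move=> iso_de [gd D2]; split; first exact: is_gdimonoid_iso gd.
have [g [/bij_inj g_inj gl gr]] := isomorphic_sym iso_de.
by move=> x y z; apply: g_inj; rewrite !(gl, gr).
Qed.

(** * Decision procedures on three elements *)

(** An explicit list, because the enumeration of the finite type ['I_3] is
    locked and does not evaluate. *)
Definition elements : seq 'I_3 := [:: elt 0; elt 1; elt 2].

Lemma elements_ind (P : 'I_3 -> Prop) :
  P (elt 0) -> P (elt 1) -> P (elt 2) -> forall x, P x.
Proof.
move=> P0 P1 P2 [[|[|[|//]]] lt_i3].
- by have -> : Ordinal lt_i3 = elt 0 by apply: val_inj.
- by have -> : Ordinal lt_i3 = elt 1 by apply: val_inj.
- by have -> : Ordinal lt_i3 = elt 2 by apply: val_inj.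
Qed.

Lemma mem_elements x : x \in elements.
Proof. by elim/elements_ind: x. Qed.

Lemma all_elementsP (P : 'I_3 -> Prop) (p : pred 'I_3) :
  (forall x, reflect (P x) (p x)) -> reflect (forall x, P x) (all p elements).
Proof.
move=> pP; apply: (iffP allP) => [Hp x|HP x _]; last exact/pP.
exact/pP/Hp/mem_elements.
Qed.

Definition eq2b (u v : 'I_3 -> 'I_3 -> 'I_3) : bool :=
  all (fun x => all (fun y => u x y == v x y) elements) elements.

Definition eq3b (u v : 'I_3 -> 'I_3 -> 'I_3 -> 'I_3) : bool :=
  all (fun x => eq2b (u x) (v x)) elements.

Lemma eq2P u v : reflect (forall x y, u x y = v x y) (eq2b u v).
Proof. by apply: all_elementsP => x; apply: all_elementsP => y; apply: eqP. Qed.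

Lemma eq3P u v : reflect (forall x y z, u x y z = v x y z) (eq3b u v).
Proof. by apply: all_elementsP => x; apply: eq2P. Qed.

Definition associativeb (u : 'I_3 -> 'I_3 -> 'I_3) : bool :=
  eq3b (fun x y z => u x (u y z)) (fun x y z => u (u x y) z).

Lemma associativeP u : reflect (associative u) (associativeb u).
Proof. exact: eq3P. Qed.

(** The two axioms that turn a pair of semigroups into a $g$-dimonoid; they
    are kept apart from associativity, which concerns one table at a time. *)
Definition linkedb (d : biop 'I_3) : bool :=
  eq3b (fun x y z => dashv d (dashv d x y) z)
       (fun x y z => dashv d x (vdash d y z)) &&
  eq3b (fun x y z => vdash d (dashv d x y) z)
       (fun x y z => vdash d x (vdash d y z)).

Definition gdimonoidb (d : biop 'I_3) : bool :=
  [&& associativeb (dashv d), associativeb (vdash d) & linkedb d].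

Lemma gdimonoidP d : reflect (is_gdimonoid d) (gdimonoidb d).
Proof.
apply: (iffP and3P) => [[/associativeP ? /associativeP ?]|[Al Ar D1 D3]].
  by case/andP=> /eq3P ? /eq3P ?; split.
by split; [exact/associativeP | exact/associativeP | apply/andP; split; exact/eq3P].
Qed.

Definition axiomD2b (d : biop 'I_3) : bool :=
  eq3b (fun x y z => dashv d (vdash d x y) z)
       (fun x y z => vdash d x (dashv d y z)).

Lemma dimonoidP d : reflect (is_dimonoid d) (gdimonoidb d && axiomD2b d).
Proof.
by apply: (iffP andP) => [[/gdimonoidP ? /eq3P]|[/gdimonoidP ? ?]]; split => //;
  apply/eq3P.
Qed.

Definition commutativeb (u : 'I_3 -> 'I_3 -> 'I_3) : bool :=
  eq2b u (fun x y => u y x).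

Lemma commutativeP d :
  reflect (is_commutative d) (commutativeb (dashv d) && commutativeb (vdash d)).
Proof.
by apply: (iffP andP) => [[/eq2P ? /eq2P ?]|[? ?]]; split => //; apply/eq2P.
Qed.

Lemma eltK (x : 'I_3) : elt x = x.
Proof. exact: valZpK. Qed.

Fixpoint words (n : nat) : seq (seq nat) :=
  if n is n'.+1 then [seq a :: w | a <- iota 0 3, w <- words n'] else [:: [::]].

Lemma mem_words (s : seq 'I_3) : map val s \in words (size s).
Proof.
elim: s => [//|x s IHs]; apply/allpairsP; exists (val x, map val s).
by split; rewrite ?mem_iota ?ltn_ord.
Qed.

Definition map_of (p : seq nat) (x : 'I_3) : 'I_3 := elt (nth 0 p x).

Lemma map_ofP (f : 'I_3 -> 'I_3) : exists2 p, p \in words 3 & map_of p =1 f.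
Proof.
exists (map val (map f elements)); first exact: mem_words.
by elim/elements_ind; rewrite /map_of /= eltK.
Qed.

Definition bijectionb (f : 'I_3 -> 'I_3) : bool :=
  all (fun x => all (fun y => (f x == f y) ==> (x == y)) elements) elements.

Definition morphismb (d e : biop 'I_3) (f : 'I_3 -> 'I_3) : bool :=
  eq2b (fun x y => f (dashv d x y)) (fun x y => dashv e (f x) (f y)) &&
  eq2b (fun x y => f (vdash d x y)) (fun x y => vdash e (f x) (f y)).

Definition isomorphicb (d e : biop 'I_3) : bool :=
  has (fun p => bijectionb (map_of p) && morphismb d e (map_of p)) (words 3).

Lemma bijectionP f : reflect (bijective f) (bijectionb f).
Proof.
have injP : reflect (injective f) (bijectionb f).
  apply: all_elementsP => x; apply: all_elementsP => y.
  by apply: (iffP implyP) => [f_inj /eqP/f_inj/eqP | f_inj /eqP/f_inj ->].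
by apply: (iffP injP) => [/injF_bij | /bij_inj].
Qed.

Lemma morphismP d e f :
  reflect ({morph f : x y / dashv d x y >-> dashv e x y} /\
           {morph f : x y / vdash d x y >-> vdash e x y}) (morphismb d e f).
Proof.
by apply: (iffP andP) => [[/eq2P ? /eq2P ?]|[? ?]]; split => //; apply/eq2P.
Qed.

Lemma isomorphicP d e : reflect (isomorphic d e) (isomorphicb d e).
Proof.
apply: (iffP hasP) => [[p _ /andP[/bijectionP bf /morphismP[fl fr]]]|].
  by exists (map_of p).
case=> f [bf fl fr]; have [p p_words pE] := map_ofP f.
exists p => //; apply/andP; split.
  by apply/bijectionP; apply: (eq_bij bf) => x; rewrite pE.
by apply/morphismP; split=> x y; rewrite !pE ?fl ?fr.
Qed.

(** * The eight representatives *)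

Definition proper_commutativeb (d : biop 'I_3) : bool :=
  [&& gdimonoidb d, commutativeb (dashv d) && commutativeb (vdash d)
    & ~~ (gdimonoidb d && axiomD2b d)].

Lemma proper_commutative_representatives :
  all proper_commutativeb representatives.
Proof. by vm_compute. Qed.

Lemma nonisomorphic_representatives :
  pairwise (fun d e => ~~ isomorphicb d e) representatives.
Proof. by vm_compute. Qed.

(** * Classification by symmetric tables *)

(** The symmetric table whose entries on and above the diagonal, read row by
    row, form the word [w]. *)
Definition symm_rows (w : seq nat) : seq (seq nat) :=
  let a i := nth 0 w i in
  [:: [:: a 0; a 1; a 2];
      [:: a 1; a 3; a 4];
      [:: a 2; a 4; a 5]].

Definition commutative_semigroups : seq (seq (seq nat)) :=
  [seq rows <- map symm_rows (words 6) | associativeb (table rows)].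

Definition of_tables (rs : seq (seq nat) * seq (seq nat)) : biop 'I_3 :=
  BiOp (table rs.1) (table rs.2).

(** The candidates are filtered in successive stages because call-by-value
    evaluation computes both sides of a conjunction: a single test would try
    the search for an isomorphism on every pair of tables. *)
Definition proper_gdimonoids : seq (seq (seq nat) * seq (seq nat)) :=
  [seq rs <- [seq rs <- [seq (r, s) | r <- commutative_semigroups,
                                      s <- commutative_semigroups]
             | linkedb (of_tables rs)]
  | ~~ axiomD2b (of_tables rs)].

Lemma classification_symm_tables :
  all (fun rs => has (isomorphicb (of_tables rs)) representatives)
    proper_gdimonoids.
Proof. by vm_compute. Qed.

Lemma symm_rowsP (u : 'I_3 -> 'I_3 -> 'I_3) :
  commutative u ->
  exists2 rows, rows \in map symm_rows (words 6) & table rows =2 u.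
Proof.
move=> uC.
pose w := [:: u (elt 0) (elt 0); u (elt 0) (elt 1); u (elt 0) (elt 2);
              u (elt 1) (elt 1); u (elt 1) (elt 2); u (elt 2) (elt 2)].
exists (symm_rows (map val w)); first exact/map_f/(mem_words w).
by elim/elements_ind; elim/elements_ind; rewrite /table /= eltK // uC.
Qed.

Lemma isomorphic_symm_tables (D : finType) (d : biop D) :
    #|D| = 3 -> is_commutative d ->
  exists r s, [/\ r \in map symm_rows (words 6), s \in map symm_rows (words 6)
                & isomorphic d (of_tables (r, s))].
Proof.
move=> D3 [dlC drC].
have [h [k hK kK]] : exists h : D -> 'I_3, bijective h.
  by rewrite -D3; exists enum_rank; exact: enum_rank_bij.
have [|r r_in rE] := @symm_rowsP (fun x y => h (dashv d (k x) (k y))).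
  by move=> x y; rewrite dlC.
have [|s s_in sE] := @symm_rowsP (fun x y => h (vdash d (k x) (k y))).
  by move=> x y; rewrite drC.
exists r, s; split=> //; exists h; split; first by exists k.
- by move=> x y /=; rewrite rE !hK.
- by move=> x y /=; rewrite sE !hK.
Qed.

Theorem mainTheorem6 :
  [/\ forall i : 'I_8,
        [/\ is_gdimonoid (tnth representatives i),
            is_commutative (tnth representatives i)
          & ~ is_dimonoid (tnth representatives i)],
      forall i j : 'I_8, i <> j ->
        ~ isomorphic (tnth representatives i) (tnth representatives j)
    & forall (D : finType) (d : biop D),
        #|D| = 3 -> is_gdimonoid d -> is_commutative d -> ~ is_dimonoid d ->
        exists i : 'I_8, isomorphic d (tnth representatives i)].
Proof.
split.
- move=> i; have /all_tnthP/(_ i) := proper_commutative_representatives.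
  case/and3P=> gi ci ndi.
  split; [exact/gdimonoidP/gi | exact/commutativeP/ci | exact/dimonoidP/ndi].
- have niso (i j : 'I_8) : i < j ->
      ~ isomorphic (tnth representatives i) (tnth representatives j).
    move=> lt_ij; apply/isomorphicP; rewrite !(tnth_nth gd1).
    have /(pairwiseP gd1) := nonisomorphic_representatives.
    by apply; rewrite // inE size_tuple.
  move=> i j ne_ij iso_ij.
  case: (ltngtP i j) => [/niso//|/niso|/val_inj//]; apply.
  exact: isomorphic_sym.
move=> D d D3 gd dC ndi.
have [r [s [r_in s_in iso_de]]] := isomorphic_symm_tables D3 dC.
set e := of_tables _ in iso_de.
have ge : gdimonoidb e by apply/gdimonoidP; exact: is_gdimonoid_iso iso_de gd.
have nD2 : ~~ axiomD2b e.
  apply/negP=> D2; apply: ndi; apply: is_dimonoid_iso (isomorphic_sym iso_de) _.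
  by apply/dimonoidP; rewrite ge.
have /and3P[Ar As linked_e] := ge.
have r_sg : r \in commutative_semigroups by rewrite mem_filter Ar.
have s_sg : s \in commutative_semigroups by rewrite mem_filter As.
have /allP/(_ (r, s)) := classification_symm_tables.
case/(_ _)/has_tnthP=> [|i /isomorphicP iso_ei].
  by rewrite !mem_filter nD2 linked_e; exact: allpairs_f.
by exists i; exact: isomorphic_trans iso_de iso_ei.
Qed.
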